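(* Let $B\subseteq\mathbb{R}^n$ be a closed convex set and let $F\subseteq\mathbb{R}^n$ be a closed set. Let $C\subseteq\mathbb{R}^n$ be a closed convex set such that $$B\cap \mathrm{bd}(F)=C\cap \mathrm{bd}(F),\qquad B\setminus \mathrm{int}(F)\subseteq C\setminus \mathrm{int}(F),$$ and such that for every $\bar x\in C\cap \mathrm{int}(F)$ there exists a finite set $\Gamma\subseteq C\cap \mathrm{bd}(F)$ with $\bar x\in \mathrm{conv}(\Gamma)$. Then $$\mathrm{conv}\bigl(B\setminus \mathrm{int}(F)\bigr)=B\cap C.$$
   Context: $\mathrm{int}$, $\mathrm{bd}$, $\mathrm{conv}$ denote topological interior, boundary, and convex hull in $\mathbb{R}^n$. *)

(* Defs.v *)
From HB Require Import structures.
From mathcomp Require Import all_boot all_order all_algebra.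
From mathcomp Require Import all_classical all_reals all_analysis.

Set Implicit Arguments.
Unset Strict Implicit.
Unset Printing Implicit Defensive.

Local Open Scope classical_set_scope.

Definition boundary (T : topologicalType) (A : set T) : set T :=
  closure A `\` interior A.

Definition convex_hull (R : numDomainType) (M : lmodType R) (A : set M) :
    set M :=
  smallest (@convex_set R M) A.

(* Main.v *)
Require Import Defs.
From HB Require Import structures.
From mathcomp Require Import all_boot all_order all_algebra.
From mathcomp Require Import all_classical all_reals all_analysis.

Set Implicit Arguments.
Unset Strict Implicit.
Unset Printing Implicit Defensive.

Import numFieldNormedType.Exports.

Local Open Scope classical_set_scope.

(** [B] and [C] are convex and both contain [B] minus the interior of [F], so minimality of the hull
    ([convex_hull_min]) gives one inclusion. Conversely, only points of [B] and [C] interior to [F]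
    need work: each is a convex combination of points of [C] on the boundary of [F]. The two sets
    agree on that boundary, so these points lie in [B] outside the interior, and monotonicity
    ([convex_hullS]) concludes. *)

Lemma convex_setI (R : numDomainType) (M : lmodType R) (A B : set M) :
  @convex_set R M A -> @convex_set R M B -> @convex_set R M (A `&` B).
Proof.
move=> cA cB x y t; rewrite !in_setI => /andP[xA xB] /andP[yA yB].
by rewrite cA ?cB.
Qed.

Lemma sub_convex_hull (R : numDomainType) (M : lmodType R) (A : set M) :
  A `<=` convex_hull A.
Proof. exact: sub_gen_smallest. Qed.

Lemma convex_hull_min (R : numDomainType) (M : lmodType R) (A D : set M) :
  @convex_set R M D -> A `<=` D -> convex_hull A `<=` D.
Proof. exact: smallest_sub. Qed.

Lemma convex_hullS (R : numDomainType) (M : lmodType R) (A D : set M) :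
  A `<=` D -> convex_hull A `<=` convex_hull D.
Proof. by move=> AD x Ax E [cE DE]; apply: Ax; split=> // y /AD /DE. Qed.

Theorem proposition3p1 (R : realType) (n : nat) (B F C : set 'rV[R]_n)
    (closedB : closed B) (convexB : @convex_set R 'rV[R]_n B)
    (closedF : closed F)
    (closedC : closed C) (convexC : @convex_set R 'rV[R]_n C)
    (eq_bd : B `&` boundary F = C `&` boundary F)
    (sub_int : B `\` interior F `<=` C `\` interior F)
    (conv_fin : forall x : 'rV[R]_n, (C `&` interior F) x ->
       exists G : set 'rV[R]_n,
         [/\ finite_set G, G `<=` C `&` boundary F & convex_hull G x]) :
  convex_hull (B `\` interior F) = B `&` C.
Proof.
apply/seteqP; split.
  apply: convex_hull_min; first exact: convex_setI.
  by move=> x BFx; split; [case: BFx | case: (sub_int _ BFx)].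
move=> x [Bx Cx].
(* Outside the interior of [F], [x] is itself one of the generating points of the hull. *)
have [Fx|nFx] := pselect (interior F x); last exact: sub_convex_hull.
have [G [_ GCF Gx]] := conv_fin x (conj Cx Fx).
(* [eq_bd] moves each point of [G] from [C] into [B]; [nFy] holds because [boundary] removes the
   interior from the closure. *)
apply: convex_hullS Gx => y /GCF; rewrite -eq_bd => -[By [_ nFy]].
by split.
Qed.
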